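(* Let $T\in\mathcal M_n(\mathbb C)$ and let $e,f,g,h$ be non-negative continuous functions on $[0,\infty)$ such that $f(t)g(t)=t$ and $e(t)h(t)=t$ for all $t\ge0$. Then for every $p>0$, $$w_p(T)\le\frac12\big\|g^2(|T^*|)+h^2(|T|)\big\|^{1/2}\,\big\|f^2(|T|)+e^2(|T^*|)\big\|_{p/2}^{1/2}.$$
   Context: $|T|=(T^*T)^{1/2}$, $|T^*|=(TT^* )^{1/2}$; functions of positive matrices via functional calculus. Singular values $s_1(T)\ge\dots\ge s_n(T)$ are the eigenvalues of $|T|$; $\|T\|=s_1(T)$; for $p>0$, $\|T\|_p=(\sum_j s_j^p(T))^{1/p}$. $\mathrm{Re}(T)=\frac12(T+T^* )$, and $w_p(T)=\max\{\|\mathrm{Re}(\lambda T)\|_p:\lambda\in\mathbb C,|\lambda|=1\}$. *)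

(* Defs.v *)
From HB Require Import structures.
From mathcomp Require Import all_boot all_order all_algebra.
From mathcomp Require Import spectral sesquilinear.
From mathcomp Require Import complex.
From mathcomp Require Import all_classical all_reals.
From mathcomp Require Import topology normedtype exp.
Set Implicit Arguments. Unset Strict Implicit. Unset Printing Implicit Defensive.
Import Order.TTheory GRing.Theory Num.Theory.
Import numFieldNormedType.Exports.
Local Open Scope ring_scope.
Local Open Scope classical_set_scope.
Local Open Scope complex_scope.
Local Open Scope sesquilinear_scope.

Section Defs.
Variable R : realType.
Notation C := (R[i]).

Definition adjmx n (A : 'M[C]_n) : 'M[C]_n := A ^t*.

(* Functional calculus f(A) for a (positive semidefinite, hence normal) matrix A,
   via the library's unitary diagonalization A = P^-1 diag(sp) P :
   f(A) = P^-1 diag(f(sp)) P, f applied to the (real) eigenvalues. *)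
Definition fcalc n (f : R -> R) (A : 'M[C]_n) : 'M[C]_n :=
  invmx (spectralmx A) *m
  diag_mx (\row_i ((f (complex.Re (spectral_diag A 0 i)))%:C)) *m spectralmx A.

Definition absmx n (T : 'M[C]_n) : 'M[C]_n := fcalc Num.sqrt (adjmx T *m T).

(* singular values of T = eigenvalues of |T| (listed with multiplicity, order irrelevant) *)
Definition singvals n (T : 'M[C]_n) (j : 'I_n) : R :=
  complex.Re (spectral_diag (absmx T) 0 j).

Definition opnorm n (T : 'M[C]_n) : R := \big[Num.max/0]_j singvals T j.

Definition schatten n (p : R) (T : 'M[C]_n) : R :=
  powR (\sum_j powR (singvals T j) p) (p^-1).

Definition ReM n (T : 'M[C]_n) : 'M[C]_n := (2%:R)^-1 *: (T + adjmx T).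

(* w_p(T) = max_{|lambda|=1} ||Re(lambda T)||_p  (max realized as sup) *)
Definition wp n (p : R) (T : 'M[C]_n) : R :=
  sup [set schatten p (ReM (l *: T)) | l in [set l : C | `|l| = 1]].

End Defs.

(* Main.v *)
Require Import Defs.
From HB Require Import structures.
From mathcomp Require Import all_boot all_order all_algebra.
From mathcomp Require Import spectral sesquilinear.
From mathcomp Require Import complex.
From mathcomp Require Import all_classical all_reals.
From mathcomp Require Import topology normedtype exp.
From mathcomp Require Import ring lra.
Import Order.TTheory GRing.Theory Num.Theory.
Import numFieldNormedType.Exports.
Local Open Scope ring_scope.
Local Open Scope classical_set_scope.

(** For [|l| = 1], [2 Re(l T) = l g(|T*|) K f(|T|) + l^* h(|T|) K' e(|T*|)] with
    contractions [K], [K'] coming from the polar decompositions of [T] and [T*].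
    Pairing with [y = 2 Re(l T) x] and using Young's inequality on each term gives,
    for [G = g^2(|T*|) + h^2(|T|)] and [B = f^2(|T|) + e^2(|T*|)],
    [|y|^2 <= ||G|| <B x, x>], that is [(2 Re(l T))^2 <= ||G|| B].  Weyl's
    monotonicity of eigenvalues turns this into
    [s_j(2 Re(l T)) <= ||G||^(1/2) s_j(B)^(1/2)], which is summed over [j].

    Vectors are rows.  Weyl monotonicity is proved by comparing, for each [t], the
    numbers of eigenvalues [>= t]; applied to any two diagonalizations, it makes
    the order and the choice of eigenbases irrelevant. *)

Section SchattenNumericalRadius.
Set Implicit Arguments.
Unset Strict Implicit.
Unset Printing Implicit Defensive.
Local Open Scope complex_scope.
Local Open Scope sesquilinear_scope.
Variable R : realType.
Implicit Types n m : nat.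
Notation C := (R[i]).

(** * The real inner product on complex row vectors *)

Definition normsq (z : C) : R := complex.Re z ^+ 2 + complex.Im z ^+ 2.

(** Taking the real part of the Hermitian product keeps all squared lengths and the adjoint rule,
    and places every inequality in [R]. *)
Definition rdot n (u v : 'rV[C]_n) : R := complex.Re ((u *m v ^t*) 0 0).

(** [P] is free rather than the chosen [spectralmx], so several matrices can share one eigenbasis:
    the rows of [P], when [P] is unitary. *)
Definition udiag n (P : 'M[C]_n) (a : 'I_n -> R) : 'M[C]_n :=
  P ^t* *m diag_mx (\row_i (a i)%:C) *m P.

Lemma trmxC_mul m n k (A : 'M[C]_(m, n)) (B : 'M[C]_(n, k)) :
  (A *m B) ^t* = B ^t* *m A ^t*.
Proof. by rewrite trmx_mul map_mxM. Qed.

Lemma trmxC_mul3 n (A B D : 'M[C]_n) :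
  (A *m B *m D) ^t* = D ^t* *m B ^t* *m A ^t*.
Proof. by rewrite trmxC_mul trmxC_mul mulmxA. Qed.

Lemma trmxCD m n (A B : 'M[C]_(m, n)) : (A + B) ^t* = A ^t* + B ^t*.
Proof. by rewrite linearD /= map_mxD. Qed.

Lemma trmxCZ m n c (A : 'M[C]_(m, n)) : (c *: A) ^t* = Num.conj c *: A ^t*.
Proof. by rewrite linearZ /= map_mxZ. Qed.

Lemma Re_mul_conj (z w : C) : complex.Re (z * Num.conj w) =
  complex.Re z * complex.Re w + complex.Im z * complex.Im w.
Proof. by case: z w => [a b] [c d] /=; rewrite mulrN opprK. Qed.

Lemma conj_realC (x : R) : Num.conj (x%:C : C) = x%:C.
Proof. by rewrite /Num.conj /= oppr0. Qed.

Lemma normsq_ge0 z : 0 <= normsq z.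
Proof. by rewrite addr_ge0 ?sqr_ge0. Qed.

Lemma normsq_eq0 z : normsq z = 0 -> z = 0.
Proof.
case: z => a b /eqP; rewrite /normsq paddr_eq0 ?sqr_ge0//= !sqrf_eq0.
by case/andP=> /eqP-> /eqP->.
Qed.

Lemma rdotE n (u v : 'rV[C]_n) : rdot u v =
  \sum_i (complex.Re (u 0 i) * complex.Re (v 0 i)
          + complex.Im (u 0 i) * complex.Im (v 0 i)).
Proof.
rewrite /rdot mxE (raddf_sum (@complex.Re R : Rcomplex R -> R)).
by apply: eq_bigr => i _; rewrite !mxE -Re_mul_conj.
Qed.

Lemma rdotC n (u v : 'rV[C]_n) : rdot u v = rdot v u.
Proof.
by rewrite !rdotE; apply: eq_bigr => i _; rewrite mulrC [X in _ + X]mulrC.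
Qed.

Lemma rdotDl n (u v w : 'rV[C]_n) : rdot (u + v) w = rdot u w + rdot v w.
Proof. by rewrite /rdot mulmxDl mxE; case: (_ 0 0) (_ 0 0) => [? ?] [? ?]. Qed.

Lemma rdotDr n (u v w : 'rV[C]_n) : rdot w (u + v) = rdot w u + rdot w v.
Proof. by rewrite ![rdot w _]rdotC rdotDl. Qed.

Lemma rdotZl n (c : R) (u w : 'rV[C]_n) : rdot (c%:C *: u) w = c * rdot u w.
Proof.
rewrite /rdot -scalemxAl mxE; case: (_ 0 0) => a b /=.
by rewrite mul0r subr0.
Qed.

Lemma rdotZr n (c : R) (u w : 'rV[C]_n) : rdot w (c%:C *: u) = c * rdot w u.
Proof. by rewrite ![rdot w _]rdotC rdotZl. Qed.

Lemma rdot_sqE n (u : 'rV[C]_n) : rdot u u = \sum_i normsq (u 0 i).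
Proof. by rewrite rdotE; apply: eq_bigr => i _; rewrite -!expr2. Qed.

Lemma rdot_ge0 n (u : 'rV[C]_n) : 0 <= rdot u u.
Proof. by rewrite rdot_sqE sumr_ge0 // => i _; exact: normsq_ge0. Qed.

Lemma rdot_eq0 n (u : 'rV[C]_n) : rdot u u = 0 -> u = 0.
Proof.
rewrite rdot_sqE => /psumr_eq0P u0; apply/rowP => i; rewrite mxE.
by apply: normsq_eq0; apply: u0 => // j _; exact: normsq_ge0.
Qed.

Lemma rdot_mulmx n (A : 'M[C]_n) (u v : 'rV[C]_n) :
  rdot (u *m A) v = rdot u (v *m A ^t*).
Proof. by rewrite /rdot trmxC_mul trmxCK mulmxA. Qed.

Lemma rdot_scale_unit n (l : C) (u : 'rV[C]_n) :
  `|l| = 1 -> rdot (l *: u) (l *: u) = rdot u u.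
Proof.
move=> l1; rewrite /rdot trmxCZ -scalemxAl -scalemxAr scalerA -normCK l1.
by rewrite expr1n scale1r.
Qed.

(** Expand the non-negative squared length of [c u - v]. *)
Lemma young_rdot n (c : R) (u v : 'rV[C]_n) : 0 < c ->
  2 * c * rdot u v <= c ^+ 2 * rdot u u + rdot v v.
Proof.
move=> c0; have := rdot_ge0 (c%:C *: u + (-1)%:C *: v).
rewrite !(rdotDl, rdotDr, rdotZl, rdotZr) (rdotC v u); lra.
Qed.

(** * Matrices diagonalized by a unitary *)

Lemma unitarymxPC n (P : 'M[C]_n) : P \is unitarymx -> P ^t* *m P = 1%:M.
Proof.
by move=> Pu; rewrite -invmx_unitary // mulVmx // unitarymx_unit.
Qed.

Lemma trmxC_udiag n (P : 'M[C]_n) a : (udiag P a) ^t* = udiag P a.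
Proof.
rewrite /udiag !trmxC_mul trmxCK mulmxA; congr (_ *m _ *m _).
rewrite tr_diag_mx map_diag_mx; congr diag_mx.
by apply/rowP => i; rewrite !mxE; exact: conj_realC.
Qed.

Lemma udiag_mul n (P : 'M[C]_n) a b : P \is unitarymx ->
  udiag P a *m udiag P b = udiag P (fun i => a i * b i).
Proof.
move=> /unitarymxP Pu; rewrite /udiag -!mulmxA; congr (_ *m _).
rewrite (mulmxA P) Pu mul1mx mulmxA mulmx_diag; congr (diag_mx _ *m _).
by apply/rowP => i; rewrite !mxE rmorphM.
Qed.

Lemma udiag_ext n (P : 'M[C]_n) a b : a =1 b -> udiag P a = udiag P b.
Proof.
by move=> /funext ->.
Qed.

Lemma udiag1 n (P : 'M[C]_n) : P \is unitarymx -> udiag P (fun=> 1) = 1%:M.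
Proof.
move=> Pu; rewrite /udiag (_ : \row__ _ = const_mx 1); last first.
  by apply/rowP => i; rewrite !mxE.
by rewrite diag_const_mx mulmx1 unitarymxPC.
Qed.

Lemma udiag_rdot n (P : 'M[C]_n) a v : rdot (v *m udiag P a) v =
  \sum_i a i * normsq ((v *m P ^t*) 0 i).
Proof.
rewrite /udiag !mulmxA rdot_mulmx rdotE; apply: eq_bigr => i _.
set w := v *m _; set d := \row__ _.
have -> : (w *m diag_mx d) 0 i = w 0 i * (a i)%:C.
  by rewrite mul_mx_diag mxE; congr (_ * _); rewrite mxE.
by case: (w 0 i) => x y; rewrite /normsq /=; ring.
Qed.

Lemma unitary_rdot n (P : 'M[C]_n) v : P \is unitarymx ->
  rdot v v = \sum_i normsq ((v *m P ^t*) 0 i).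
Proof.
move=> Pu; rewrite -rdot_sqE rdot_mulmx trmxCK -mulmxA.
by rewrite unitarymxPC // mulmx1.
Qed.

Lemma udiagD n (P : 'M[C]_n) a b :
  udiag P (fun i => a i + b i) = udiag P a + udiag P b.
Proof.
rewrite /udiag -mulmxDl -mulmxDr -linearD; congr (_ *m diag_mx _ *m _).
by apply/rowP => i; rewrite !mxE rmorphD.
Qed.

Lemma udiag0 n (P : 'M[C]_n) : udiag P (fun=> 0) = 0.
Proof.
rewrite /udiag (_ : \row__ _ = 0) ?raddf0 ?mulmx0 ?mul0mx //.
by apply/rowP => i; rewrite !mxE.
Qed.

(** Changing bases on both sides is reversible, so an intertwining relation can be read off between
    the diagonal factors alone. *)
Lemma conjmx_intertwine (F : nzRingType) n (P P' Q Q' X D E : 'M[F]_n) :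
  P *m P' = 1%:M -> P' *m P = 1%:M -> Q *m Q' = 1%:M -> Q' *m Q = 1%:M ->
  (P' *m D *m P) *m X = X *m (Q' *m E *m Q) <->
  D *m (P *m X *m Q') = (P *m X *m Q') *m E.
Proof.
move=> PP' P'P QQ' Q'Q.
split=> [/(congr1 (fun Z => P *m Z *m Q'))|/(congr1 (fun Z => P' *m Z *m Q))].
  by rewrite !mulmxA PP' mul1mx -!mulmxA QQ' mulmx1.
by rewrite -!mulmxA Q'Q mulmx1 !mulmxA P'P mul1mx.
Qed.

(* In eigenbases the intertwining relation reads [K i j * b j = a i * K i j], so
   [a i = b j] wherever [K i j != 0]. *)
Lemma udiag_intertwine n (P Q X : 'M[C]_n) a b (f : R -> R) :
  P \is unitarymx -> Q \is unitarymx ->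
  udiag P a *m X = X *m udiag Q b ->
  udiag P (f \o a) *m X = X *m udiag Q (f \o b).
Proof.
move=> Pu Qu.
have eqK a' b' := conjmx_intertwine X (diag_mx (\row_i (a' i)%:C))
  (diag_mx (\row_i (b' i)%:C)) (unitarymxP Pu) (unitarymxPC Pu) (unitarymxP Qu)
  (unitarymxPC Qu).
move=> /eqK /matrixP e; apply/eqK/matrixP => i j.
have := e i j; rewrite !mul_diag_mx !mul_mx_diag !mxE /=; set k := \sum__ _.
have [->|k0] := eqVneq k 0; first by rewrite !mulr0 !mul0r.
by rewrite mulrC => /(mulfI k0) [->]; rewrite mulrC.
Qed.

Opaque udiag.

(** * Eigenvalue counting and Weyl monotonicity *)

(** Once both lists are sorted decreasingly, the counts force entrywise domination. Monotonicity of
    [phi] is asked only across the two lists because real powers are compared on non-negative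
    arguments. *)
Lemma sum_le_of_count (phi : R -> R) (s1 s2 : seq R) :
  {in s1 & s2, forall x y, x <= y -> phi x <= phi y} ->
  size s1 = size s2 ->
  (forall t, (count (>= t) s1 <= count (>= t) s2)%N) ->
  \sum_(x <- s1) phi x <= \sum_(x <- s2) phi x.
Proof.
have ge_trans : transitive (>=%R : rel R) by move=> y x z xy yz; exact: le_trans xy.
have ge_total : total (>=%R : rel R) by move=> x y; exact: le_total.
rewrite -(perm_big _ (permEl (perm_sort >=%R s1)))
  -[leRHS](perm_big _ (permEl (perm_sort >=%R s2))) /=.
move=> phi_le; rewrite -(size_sort >=%R s1) -(size_sort >=%R s2) => eq_sz cnt.
have {}cnt t : (count (>= t) (sort >=%R s1) <= count (>= t) (sort >=%R s2))%N.
  by rewrite !count_sort.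
have {phi_le} : {in sort >=%R s1 & sort >=%R s2,
    forall x y, x <= y -> phi x <= phi y}.
  by move=> x y; rewrite !mem_sort; exact: phi_le.
have := sort_sorted ge_total s2; have := sort_sorted ge_total s1.
elim: (sort _ s1) (sort _ s2) eq_sz cnt => [|x {}s1 IH] [|y {}s2] //=.
move=> [eq_sz] cnt; rewrite !path_sortedE // => /andP[ge_x sorted1].
move=> /andP[ge_y sorted2] phi_le.
(* Take the threshold [x]: if [y < x], the second list has no entry above it, while the first has at
   least its head. *)
have le_xy : x <= y.
  rewrite leNgt; apply/negP => lt_yx; have := cnt x.
  rewrite lexx (lt_geF lt_yx) (@eq_in_count _ _ pred0 s2) ?count_pred0 //.
  by move=> z /(allP ge_y) /= le_zy; rewrite leNgt (le_lt_trans le_zy lt_yx).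
rewrite !big_cons lerD //; first by apply: phi_le; rewrite ?mem_head.
apply: IH => // [t|u v us1 vs2]; last first.
  by apply: phi_le; rewrite inE (us1, vs2) orbT.
(* The tails inherit the count hypothesis: for [t <= x] both heads are counted and cancel, and for
   [t > x] the first tail counts nothing. *)
have := cnt t; have [le_tx|lt_xt] := leP t x.
  by rewrite (le_trans le_tx le_xy) leq_add2l.
move=> _; rewrite (@eq_in_count _ _ pred0) ?count_pred0 //.
by move=> z /(allP ge_x) /= le_zx; rewrite leNgt (le_lt_trans le_zx lt_xt).
Qed.

Lemma sum_le_of_card n (phi : R -> R) (a b : 'I_n -> R) :
  (forall i j, a i <= b j -> phi (a i) <= phi (b j)) ->
  (forall t, (#|[set i | (t <= a i)%R]%SET| <= #|[set i | (t <= b i)%R]%SET|)%N) ->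
  \sum_i phi (a i) <= \sum_i phi (b i).
Proof.
move=> phi_le card_le.
have sumE (c : 'I_n -> R) :
    \sum_i phi (c i) = \sum_(x <- [seq c i | i <- enum 'I_n]) phi x.
  by rewrite big_map big_enum.
rewrite !sumE; apply: sum_le_of_count => [_ _ /mapP[i _ ->] /mapP[j _ ->]||t].
- exact: phi_le.
- by rewrite !size_map.
- have cntE (c : 'I_n -> R) : count (>= t) [seq c i | i <- enum 'I_n] =
      #|[set i | (t <= c i)%R]%SET|.
    rewrite enumT count_map cardE /enum_mem size_filter.
    by apply: eq_count => i /=; rewrite inE.
  by rewrite !cntE.
Qed.

(** A dimension count: there are [#|S|] unknowns and only [#|S'|] linear equations. *)
Lemma exists_row_support (F : fieldType) n (M : 'M[F]_n) (S S' : {set 'I_n}) :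
  (#|S'| < #|S|)%N -> exists u : 'rV[F]_n,
  [/\ u != 0, forall i, i \notin S -> u 0 i = 0
    & forall j, j \in S' -> (u *m M) 0 j = 0].
Proof.
move=> ltS.
pose N : 'M_(#|S|, #|S'|) := mxsub enum_val enum_val M.
have : kermx N != 0.
  by rewrite kermx_eq0 /row_free neq_ltn (leq_ltn_trans (rank_leq_col N)).
case/rowV0Pn => w /sub_kermxP wN w0.
(* Right multiplication by [E] extends a row indexed by [S] by zero to all indices. *)
pose E : 'M[F]_(#|S|, n) := rowsub enum_val 1%:M.
have uE k : (w *m E) 0 (enum_val k) = w 0 k.
  rewrite mxE (bigD1 k) //= big1 => [|k' k'k]; rewrite !mxE.
    by rewrite eqxx mulr1 addr0.
  by rewrite (inj_eq enum_val_inj) (negbTE k'k) mulr0.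
exists (w *m E); split.
- apply: contraNneq w0 => u0; apply/eqP/rowP => k.
  by rewrite -uE u0 !mxE.
- move=> i iS; rewrite mxE big1 // => k _; rewrite !mxE.
  case: eqP => [ki|]; last by rewrite mulr0.
  by move: iS; rewrite -ki enum_valP.
- move=> j jS; rewrite -mulmxA mul_rowsub_mx mul1mx.
  have /rowP/(_ (enum_rank_in jS j)) := wN; rewrite [RHS]mxE => <-.
  rewrite !mxE; apply: eq_bigr => k _.
  by rewrite !mxE enum_rankK_in.
Qed.

(** Otherwise some nonzero [v = u *m P] lies in the span of the [P]-eigenvectors with [a i >= t] and
    is orthogonal to the [Q]-eigenvectors with [b i >= t]. The first form is then at least [t |v|^2]
    at [v] and the second is strictly below it. *)
Lemma weyl_card n (P Q : 'M[C]_n) a b :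
  P \is unitarymx -> Q \is unitarymx ->
  (forall v, rdot (v *m udiag P a) v <= rdot (v *m udiag Q b) v) ->
  forall t, (#|[set i | (t <= a i)%R]%SET| <= #|[set i | (t <= b i)%R]%SET|)%N.
Proof.
move=> Pu Qu leAB t; rewrite leqNgt; apply/negP => lt_ba.
have [u [u0 u_out uM0]] := exists_row_support (P *m Q ^t*) lt_ba.
have vP : u *m P *m P ^t* = u by rewrite -mulmxA (unitarymxP Pu) mulmx1.
pose w := u *m P *m Q ^t*.
have w0 : forall i, t <= b i -> normsq (w 0 i) = 0.
  move=> i tb; have := uM0 i; rewrite inE tb mulmxA => /(_ isT).
  by rewrite -/w => ->; rewrite /normsq /= expr0n addr0.
have ge_t : t * rdot (u *m P) (u *m P) <= rdot (u *m P *m udiag P a) (u *m P).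
  rewrite (unitary_rdot _ Pu) udiag_rdot vP mulr_sumr ler_sum // => i _.
  have [le_ta|lt_at] := boolP (t <= a i); first by rewrite ler_wpM2r ?normsq_ge0.
  by rewrite u_out ?inE // /normsq /= expr0n addr0 !mulr0.
have term_ge0 (i : 'I_n) : true -> 0 <= (t - b i) * normsq (w 0 i).
  move=> _; have [/w0->|lt_bt] := leP t (b i); first by rewrite mulr0.
  by rewrite mulr_ge0 ?normsq_ge0 // subr_ge0 ltW.
(* The sum equals [t |v|^2] minus the second form at [v], hence is at most 0, while all its terms
   are non-negative. *)
have sum0 : \sum_i (t - b i) * normsq (w 0 i) = 0.
  apply/eqP; rewrite eq_le sumr_ge0 ?andbT //.
  rewrite (eq_bigr (fun i => t * normsq (w 0 i) - b i * normsq (w 0 i))); last first.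
    by move=> i _; rewrite mulrBl.
  rewrite sumrB subr_le0 -mulr_sumr -(unitary_rdot _ Qu) -udiag_rdot.
  exact: le_trans (leAB _).
have wz : w = 0.
  apply/rowP => i; rewrite [RHS]mxE; apply: normsq_eq0.
  have [/w0//|lt_bt] := leP t (b i).
  have /eqP := @psumr_eq0P _ _ _ _ term_ge0 sum0 i isT.
  by rewrite mulf_eq0 subr_eq0 gt_eqF //= => /eqP.
move/eqP: u0; apply; rewrite -vP.
have -> : u *m P = w *m Q by rewrite /w -mulmxA unitarymxPC // mulmx1.
by rewrite wz !mul0mx.
Qed.

(** * Positive semidefinite matrices and functional calculus *)

(** Self-adjointness is a separate clause because [rdot] keeps only the real part of the quadratic
    form, which does not see a skew-adjoint part. *)
Definition psdmx n (A : 'M[C]_n) : Prop :=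
  A ^t* = A /\ forall v, 0 <= rdot (v *m A) v.

Lemma psdmx_udiag n (P : 'M[C]_n) a : (forall i, 0 <= a i) -> psdmx (udiag P a).
Proof.
move=> a0; split; first exact: trmxC_udiag.
by move=> v; rewrite udiag_rdot sumr_ge0 // => i _; rewrite mulr_ge0 ?normsq_ge0.
Qed.

Lemma psdmx_gram n (A : 'M[C]_n) : psdmx (A ^t* *m A).
Proof.
split=> [|v]; first by rewrite trmxC_mul trmxCK.
by rewrite mulmxA rdot_mulmx rdot_ge0.
Qed.

Lemma psdmxD n (A B : 'M[C]_n) : psdmx A -> psdmx B -> psdmx (A + B).
Proof.
move=> [Ah A0] [Bh B0]; split; first by rewrite trmxCD Ah Bh.
by move=> v; rewrite mulmxDr rdotDl addr_ge0.
Qed.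

Definition eigval n (A : 'M[C]_n) i : R := complex.Re (spectral_diag A 0 i).

Lemma fcalcE n f (A : 'M[C]_n) :
  fcalc f A = udiag (spectralmx A) (fun i => f (eigval A i)).
Proof. by rewrite /fcalc (invmx_unitary (spectral_unitarymx A)). Qed.

Lemma hermitian_udiag n (A : 'M[C]_n) :
  A ^t* = A -> A = udiag (spectralmx A) (eigval A).
Proof.
move=> Ah; have Aherm : A \is hermsymmx.
  by apply/is_hermitianmxP; rewrite expr0 scale1r Ah.
have /orthomx_spectralP {1}-> := hermitian_normalmx Aherm.
have -> : spectral_diag A = \row_i (eigval A i)%:C.
  apply/rowP => i; rewrite mxE.
  by have /mxOverP/(_ 0 i)/RRe_real := hermitian_spectral_diag_real Aherm.
by rewrite (invmx_unitary (spectral_unitarymx A)).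
Qed.

(** Test the form on the eigenvector [row i P]. *)
Lemma udiag_coef_ge0 n (P : 'M[C]_n) a i : P \is unitarymx ->
  (forall v, 0 <= rdot (v *m udiag P a) v) -> 0 <= a i.
Proof.
move=> Pu /(_ (row i P)); rewrite udiag_rdot.
have -> : row i P *m P ^t* = row i 1%:M by rewrite -row_mul (unitarymxP Pu).
rewrite (bigD1 i) //= big1 => [|j ji]; rewrite !mxE.
  by rewrite eqxx /normsq /= expr1n expr0n !addr0 mulr1.
by rewrite eq_sym (negbTE ji) /normsq /= expr0n addr0 mulr0.
Qed.

Lemma eigval_ge0 n (A : 'M[C]_n) i : psdmx A -> 0 <= eigval A i.
Proof.
move=> [Ah A0]; apply: (udiag_coef_ge0 (P := spectralmx A)).
  exact: spectral_unitarymx.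
by rewrite -hermitian_udiag.
Qed.

(** Functional calculus does not depend on the diagonalization: the identity intertwines any two of
    them, so [udiag_intertwine] applies with [X = 1]. *)
Lemma fcalc_udiag n f (P : 'M[C]_n) a : P \is unitarymx ->
  fcalc f (udiag P a) = udiag P (f \o a).
Proof.
move=> Pu; rewrite fcalcE -[LHS]mulmx1 -[RHS]mul1mx.
apply: (udiag_intertwine (a := eigval (udiag P a)) f (spectral_unitarymx _) Pu).
by rewrite mulmx1 mul1mx -hermitian_udiag // trmxC_udiag.
Qed.

(** * Absolute values and singular values *)

Lemma udiag_sqr n (A P : 'M[C]_n) a : P \is unitarymx -> A = udiag P a ->
  A *m A = udiag P (fun i => a i ^+ 2).
Proof. by move=> Pu ->; exact: udiag_mul. Qed.

Lemma absmxP n (T : 'M[C]_n) : exists2 W : 'M[C]_n, W \is unitarymx &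
  exists2 s : 'I_n -> R, forall i, 0 <= s i &
  T ^t* *m T = udiag W (fun i => s i ^+ 2) /\ absmx T = udiag W s.
Proof.
have psdG := psdmx_gram T; have [Gh _] := psdG.
exists (spectralmx (T ^t* *m T)); first exact: spectral_unitarymx.
exists (fun i => Num.sqrt (eigval (T ^t* *m T) i)) => [i|]; first exact: sqrtr_ge0.
split; last exact: fcalcE.
apply: (etrans (hermitian_udiag Gh)); apply: udiag_ext => i.
by rewrite sqr_sqrtr // eigval_ge0.
Qed.

Lemma absmx_psd n (T : 'M[C]_n) : psdmx (absmx T).
Proof. by have [W _ [s s0 [_ ->]]] := absmxP T; exact: psdmx_udiag. Qed.

Lemma absmx_sqr n (T : 'M[C]_n) : absmx T *m absmx T = T ^t* *m T.
Proof.
by have [W Wu [s _ [-> TE]]] := absmxP T; exact: udiag_sqr.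
Qed.

(** Lets the singular values of a positive semidefinite matrix serve as its eigenvalues. *)
Lemma absmx_id n (A : 'M[C]_n) : psdmx A -> absmx A = A.
Proof.
move=> psdA; have [Ah _] := psdA.
have Pu := spectral_unitarymx A.
have AE := hermitian_udiag Ah.
rewrite /absmx /adjmx Ah (udiag_sqr Pu AE) (fcalc_udiag _ _ Pu).
rewrite [RHS]AE; apply: udiag_ext => i /=.
by rewrite sqrtr_sqr ger0_norm // eigval_ge0.
Qed.

Lemma singvals_ge0 n (T : 'M[C]_n) i : 0 <= singvals T i.
Proof. exact/eigval_ge0/absmx_psd. Qed.

Lemma absmx_singvals n (T : 'M[C]_n) :
  absmx T = udiag (spectralmx (absmx T)) (singvals T).
Proof. by apply: hermitian_udiag; have [] := absmx_psd T. Qed.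

Lemma psd_le_opnorm n (A : 'M[C]_n) v : psdmx A ->
  rdot (v *m A) v <= opnorm A * rdot v v.
Proof.
move=> /absmx_id AE; rewrite -{1}AE {1}absmx_singvals udiag_rdot.
rewrite (unitary_rdot _ (spectral_unitarymx (absmx A))) mulr_sumr ler_sum // => i _.
by rewrite ler_wpM2r ?normsq_ge0 // /opnorm le_bigmax.
Qed.

Lemma opnorm_ge0 n (A : 'M[C]_n) : 0 <= opnorm A.
Proof. exact: bigmax_ge_id. Qed.

(** The last hypothesis says [M ^t* *m M <= c B] as forms. The eigenvalues are [singvals M j ^+ 2]
    on the left and [c * singvals B j] on the right, so Weyl counting compares the sums of their
    [q]-th powers. *)
Lemma sum_singvals_le n (M B : 'M[C]_n) (c q : R) : psdmx B -> 0 <= c -> 0 <= q ->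
  (forall v, rdot (v *m M ^t*) (v *m M ^t*) <= c * rdot (v *m B) v) ->
  \sum_j powR (singvals M j ^+ 2) q <= powR c q * \sum_j powR (singvals B j) q.
Proof.
move=> psdB c0 q0 le_MB.
have Pu := spectral_unitarymx (absmx M); have Qu := spectral_unitarymx (absmx B).
rewrite mulr_sumr.
under [leRHS]eq_bigr do rewrite -powRM ?singvals_ge0 //.
apply: (sum_le_of_card (phi := fun x => powR x q)) => [i j le_ij|].
  by rewrite ge0_ler_powR // nnegrE ?sqr_ge0 ?mulr_ge0 ?singvals_ge0.
apply: (weyl_card Pu Qu) => v.
have <- : M ^t* *m M = udiag (spectralmx (absmx M)) (fun i => singvals M i ^+ 2).
  by rewrite -absmx_sqr; exact: (udiag_sqr Pu (absmx_singvals M)).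
have BE := etrans (esym (absmx_id psdB)) (absmx_singvals B).
rewrite (mulmxA v) rdot_mulmx (le_trans (le_MB v)) // {1}BE !udiag_rdot mulr_sumr.
by apply: ler_sum => i _; rewrite mulrA.
Qed.

(** * Polar factorization and the two-term estimate *)

Lemma rdot_udiag_sqr n (P : 'M[C]_n) a v : P \is unitarymx ->
  rdot (v *m udiag P (fun i => a i ^+ 2)) v = rdot (v *m udiag P a) (v *m udiag P a).
Proof.
move=> Pu; transitivity (rdot (v *m udiag P a *m udiag P a) v).
  by rewrite -(mulmxA v) (udiag_mul _ _ Pu).
by rewrite rdot_mulmx trmxC_udiag.
Qed.

Lemma gram_eq0 n (A : 'M[C]_n) : A ^t* *m A = 0 -> A = 0.
Proof.
move=> A0; rewrite -[A]trmxCK (_ : A ^t* = 0); last first.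
  apply/row_matrixP => i; rewrite rowE row0; apply: rdot_eq0.
  by rewrite -rdot_mulmx -mulmxA A0 mulmx0 /rdot mul0mx mxE.
by rewrite trmx0 map_mx0.
Qed.

(* The contraction is [T |T|^-1], with [s^-1 = 0] at [s = 0]: the partial isometry
   of the polar decomposition. *)
Lemma polar_factor n (T V W : 'M[C]_n) (s t : 'I_n -> R) (f g : R -> R) :
  W \is unitarymx -> V \is unitarymx ->
  (forall i, 0 <= s i) -> (forall i, 0 <= t i) ->
  T ^t* *m T = udiag W (fun i => s i ^+ 2) ->
  T *m T ^t* = udiag V (fun i => t i ^+ 2) ->
  (forall x, 0 <= x -> f x * g x = x) ->
  exists2 K : 'M[C]_n, T = udiag V (g \o t) *m K *m udiag W (f \o s) &
    forall v, rdot (v *m K ^t*) (v *m K ^t*) <= rdot v v.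
Proof.
move=> Wu Vu s0 t0 TtT TTt fg.
(* This is [g(|T*|) T = T g(|T|)]: [T] intertwines [T *m T ^t*] with [T ^t* *m T], hence also their
   images under [g \o Num.sqrt]. *)
have gT : udiag V (g \o t) *m T = T *m udiag W (g \o s).
  have sq (r : 'I_n -> R) : (forall i, 0 <= r i) ->
      g \o r =1 (g \o Num.sqrt) \o (fun i => r i ^+ 2).
    by move=> r0 i /=; rewrite sqrtr_sqr ger0_norm.
  rewrite (udiag_ext V (sq t t0)) (udiag_ext W (sq s s0)).
  by apply: (udiag_intertwine _ Vu Wu); rewrite -TTt -TtT mulmxA.
exists (T *m udiag W (fun i => (s i)^-1)) => [|v].
  (* [E] is 1 where [s i != 0] and 0 elsewhere, so [udiag W E] projects onto the support of
     [|T|]. *)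
  pose E i := s i / s i.
  have -> : udiag V (g \o t) *m (T *m udiag W (fun i => (s i)^-1))
              *m udiag W (f \o s) = T *m udiag W E.
    rewrite mulmxA gT -(mulmxA T (udiag W _)) -(mulmxA T) 2!(udiag_mul _ _ Wu).
    congr (T *m _).
    by apply: udiag_ext => i /=; rewrite mulrC mulrA (fg _ (s0 i)).
  (* [T] vanishes off that support: the Gram matrix of this product has coefficients
     [(1 - E i) * s i ^+ 2 * (1 - E i)], all 0. *)
  have TE0 : T *m udiag W (fun i => 1 - E i) = 0.
    apply: gram_eq0; rewrite trmxC_mul trmxC_udiag mulmxA -(mulmxA _ _ T) TtT.
    rewrite 2!(udiag_mul _ _ Wu) -[RHS](udiag0 W); apply: udiag_ext => i; rewrite /E.
    have [->|si0] := eqVneq (s i) 0; first by rewrite expr0n mulr0 mul0r.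
    by rewrite divff // subrr !mul0r.
  rewrite -[LHS]mulmx1 -(udiag1 Wu) -[RHS]addr0 -TE0 -mulmxDr -udiagD.
  by congr (T *m _); apply: udiag_ext => i; rewrite addrC subrK.
rewrite -rdot_mulmx trmxC_mul trmxC_udiag -mulmxA.
(* The coefficients of [K ^t* *m K] are 0 or 1, which makes [K] a contraction. *)
rewrite (_ : _ *m _ *m _ = udiag W (fun i => (s i)^-1 * s i ^+ 2 * (s i)^-1)).
  rewrite udiag_rdot (unitary_rdot v Wu); apply: ler_sum => i _.
  rewrite -[leRHS]mul1r ler_wpM2r ?normsq_ge0 //.
  have [->|si0] := eqVneq (s i) 0; first by rewrite invr0 mulr0.
  by rewrite expr2 mulKf // divff.
by rewrite mulmxA -(mulmxA _ _ T) TtT 2!(udiag_mul _ _ Wu).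
Qed.

(* With [y := x *m N], expand [rdot y y] and apply Young's inequality to each of
   the two terms with weight [c]. *)
Lemma rdot_two_factor_le n (F1 F2 K1 K2 G1 G2 : 'M[C]_n) (l1 l2 : C) (c : R) x :
  let N := l1 *: (F1 *m K1 *m G1) + l2 *: (F2 *m K2 *m G2) in
  `|l1| = 1 -> `|l2| = 1 -> G1 ^t* = G1 -> G2 ^t* = G2 ->
  (forall v, rdot (v *m K1) (v *m K1) <= rdot v v) ->
  (forall v, rdot (v *m K2) (v *m K2) <= rdot v v) ->
  0 <= c ->
  (forall v, rdot (v *m G1) (v *m G1) + rdot (v *m G2) (v *m G2) <= c * rdot v v) ->
  rdot (x *m N) (x *m N) <=
    c * (rdot (x *m F1) (x *m F1) + rdot (x *m F2) (x *m F2)).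
Proof.
move=> N l1n l2n G1h G2h K1c K2c c0 Gle.
set y := x *m N.
pose u1 := l1 *: (x *m F1 *m K1); pose u2 := l2 *: (x *m F2 *m K2).
(* Since [y = u1 *m G1 + u2 *m G2], the self-adjoint [G1] and [G2] move to the other side of the
   product. *)
have yE : rdot y y = rdot u1 (y *m G1) + rdot u2 (y *m G2).
  rewrite -[in X in _ = X + _]G1h -[in X in _ = _ + X]G2h -!rdot_mulmx -rdotDl.
  congr rdot; rewrite /y /u1 /u2 /N mulmxDr -!scalemxAr -!scalemxAl.
  by rewrite !mulmxA.
have u1le : rdot u1 u1 <= rdot (x *m F1) (x *m F1).
  by rewrite rdot_scale_unit.
have u2le : rdot u2 u2 <= rdot (x *m F2) (x *m F2).
  by rewrite rdot_scale_unit.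
have := Gle y; have := rdot_ge0 (y *m G1); have := rdot_ge0 (y *m G2).
(* Young's inequality needs [c > 0]. When [c = 0], both [y *m G1] and [y *m G2] vanish, and so does
   [rdot y y]. *)
move: c0; rewrite le_eqVlt => /predU1P[<-|c0] g2 g1.
  rewrite !mul0r => g12.
  have yG1 : y *m G1 = 0.
    by apply/rdot_eq0/eqP; rewrite eq_le g1 andbT (le_trans _ g12) // lerDl.
  have yG2 : y *m G2 = 0.
    by apply/rdot_eq0/eqP; rewrite eq_le g2 andbT (le_trans _ g12) // lerDr.
  by rewrite yE yG1 yG2 /rdot trmx0 map_mx0 !mulmx0 mxE addr0.
(* The two Young bounds add up to [2c|y|^2 <= c^2(|u1|^2 + |u2|^2) + c|y|^2]; one [c|y|^2] is
   absorbed on the left. *)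
move=> g12; rewrite -(ler_pM2l c0).
have : c ^+ 2 * (rdot u1 u1 + rdot u2 u2) <=
    c ^+ 2 * (rdot (x *m F1) (x *m F1) + rdot (x *m F2) (x *m F2)).
  by rewrite ler_wpM2l ?sqr_ge0 ?lerD.
move: (young_rdot u1 (y *m G1) c0) (young_rdot u2 (y *m G2) c0) g12.
rewrite yE; move: (rdot _ _) (rdot _ _) (rdot _ _) (rdot _ _) (rdot _ _) (rdot _ _)
  (rdot _ _) (rdot _ _) => d1 U1 V1 d2 U2 V2 B1 B2; lra.
Qed.

(** * Schatten bounds for the real part *)

(** Source of the factor 1/2 in the final bound: the 1/2 in [ReM] becomes 1/4 after squaring. *)
Lemma powR_quarter_half (c : R) : 0 <= c ->
  powR (c / 4) 2^-1 = 2^-1 * powR c 2^-1.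
Proof.
move=> c0; rewrite powRM ?invr_ge0 // mulrC; congr (_ * _).
have -> : 4^-1 = (2^-1 : R) ^+ 2 by rewrite exprVn -natrX.
by rewrite powR12_sqrt ?sqr_ge0 // sqrtr_sqr ger0_norm ?invr_ge0.
Qed.

(** Use [sum_singvals_le] with [q = p / 2], then take the power [p^-1] of both sides. *)
Lemma schatten_le n (M B : 'M[C]_n) (c p : R) : psdmx B -> 0 <= c -> 0 < p ->
  (forall v, rdot (v *m M ^t*) (v *m M ^t*) <= c * rdot (v *m B) v) ->
  schatten p M <= powR c 2^-1 * powR (schatten (p / 2) B) 2^-1.
Proof.
move=> psdB c0 p0 MB.
have p20 : 0 <= p / 2 by rewrite divr_ge0 // ltW.
have pE : p / 2 * p^-1 = 2^-1 by rewrite mulrAC divff ?mul1r // gt_eqF.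
have S0 : 0 <= \sum_j powR (singvals B j) (p / 2).
  by rewrite sumr_ge0 // => j _; exact: powR_ge0.
rewrite /schatten -powRrM.
have -> : (p / 2)^-1 * 2^-1 = p^-1 by rewrite invf_div mulrAC divff ?mul1r ?pnatr_eq0.
rewrite -[in powR c _]pE (powRrM c) -(powRM _ (powR_ge0 _ _) S0).
have pV0 : 0 <= p^-1 by rewrite invr_ge0 ltW.
have sumM : \sum_j powR (singvals M j) p = \sum_j powR (singvals M j ^+ 2) (p / 2).
  apply: eq_bigr => j _; rewrite -powR_mulrn ?singvals_ge0 // -powRrM mulrC.
  by rewrite divfK ?pnatr_eq0.
have := sum_singvals_le psdB c0 p20 MB; rewrite -sumM => le_sum.
have S'0 : \sum_j powR (singvals M j) p \is Num.nneg.
  by rewrite nnegrE; apply: sumr_ge0 => j _; exact: powR_ge0.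
have cS0 : powR c (p / 2) * \sum_j powR (singvals B j) (p / 2) \is Num.nneg.
  by rewrite nnegrE; exact: mulr_ge0 (powR_ge0 _ _) S0.
exact: (ge0_ler_powR pV0 S'0 cS0 le_sum).
Qed.

Lemma schatten_ReM_le n (T : 'M[C]_n) (e f g h : R -> R) (p : R) (l : C) :
  (forall t, 0 <= t -> f t * g t = t) -> (forall t, 0 <= t -> e t * h t = t) ->
  0 < p -> `|l| = 1 ->
  schatten p (Defs.ReM (l *: T)) <=
    2^-1 * powR (opnorm (fcalc (fun t => g t ^+ 2) (absmx (adjmx T))
                         + fcalc (fun t => h t ^+ 2) (absmx T))) (2^-1)
         * powR (schatten (p / 2) (fcalc (fun t => f t ^+ 2) (absmx T)
                                  + fcalc (fun t => e t ^+ 2) (absmx (adjmx T)))) (2^-1).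
Proof.
move=> fg eh p0 l1.
have [W Wu [s s0 [TtT absT]]] := absmxP T.
have [V Vu [t t0 [TTt absT']]] := absmxP (T ^t*).
(* For the adjoint, the two eigenbases exchange roles: [T* = h(|T|) K' e(|T*|)]. *)
have [K' T'E K'c] := polar_factor Vu Wu t0 s0 TTt (etrans (congr1 _ (trmxCK T)) TtT) eh.
rewrite trmxCK in TTt.
have [K TE Kc] := polar_factor Wu Vu s0 t0 TtT TTt fg.
rewrite -/(adjmx T) in absT'.
rewrite absT absT' !(fcalc_udiag _ _ Vu) !(fcalc_udiag _ _ Wu).
set G := _ + _; set B := _ + _.
have psd_sq (P : 'M[C]_n) (a : 'I_n -> R) (k : R -> R) :
    psdmx (udiag P ((fun x => k x ^+ 2) \o a)).
  by apply: psdmx_udiag => i; exact: sqr_ge0.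
have psdG : psdmx G by exact: psdmxD (psd_sq _ _ _) (psd_sq _ _ _).
have psdB : psdmx B by exact: psdmxD (psd_sq _ _ _) (psd_sq _ _ _).
rewrite -powR_quarter_half ?opnorm_ge0 //.
apply: schatten_le => // [|v]; first by rewrite divr_ge0 ?opnorm_ge0.
(* [N] is [2 Re(l T)], with [T*] expanded by the adjoint of the first factorization and [T] by that
   of the second. Rows meet the left factors [f(|T|)] and [e(|T*|)] first, so these produce [B] and
   the right factors produce [G]. *)
pose N := Num.conj l *: (udiag W (f \o s) *m K ^t* *m udiag V (g \o t))
  + l *: (udiag V (e \o t) *m K' ^t* *m udiag W (h \o s)).
have TtE : T ^t* = udiag W (f \o s) *m K ^t* *m udiag V (g \o t).
  by rewrite {1}TE trmxC_mul3 2!trmxC_udiag.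
have T_E : T = udiag V (e \o t) *m K' ^t* *m udiag W (h \o s).
  by rewrite -[LHS]trmxCK T'E trmxC_mul3 2!trmxC_udiag.
have NE : (Defs.ReM (l *: T)) ^t* = (2^-1)%:C *: N.
  rewrite /Defs.ReM /adjmx trmxCZ trmxCD trmxCK trmxCZ TtE {1}T_E.
  by congr (_ *: _); rewrite !fmorphV !rmorph_nat.
have sqE (P : 'M[C]_n) (a : 'I_n -> R) (k : R -> R) (u : 'rV_n) : P \is unitarymx ->
    rdot (u *m udiag P ((fun x => k x ^+ 2) \o a)) u =
    rdot (u *m udiag P (k \o a)) (u *m udiag P (k \o a)).
  exact: rdot_udiag_sqr.
have Gle u : rdot (u *m udiag V (g \o t)) (u *m udiag V (g \o t))
    + rdot (u *m udiag W (h \o s)) (u *m udiag W (h \o s)) <= opnorm G * rdot u u.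
  by rewrite -!sqE // -rdotDl -mulmxDr; exact: psd_le_opnorm.
have cl1 : `|Num.conj l| = 1 by rewrite norm_conjC.
have := rdot_two_factor_le (udiag W (f \o s)) (udiag V (e \o t)) v cl1 l1 (trmxC_udiag _ _) (trmxC_udiag _ _) Kc K'c
  (opnorm_ge0 G) Gle.
(* The scalar 1/2 leaves both slots of [rdot], matching the constant [opnorm G / 4]. *)
rewrite -/N -!sqE // -rdotDl -mulmxDr -/B NE -scalemxAr rdotZl rdotZr.
move: (rdot _ _) (rdot _ _) (opnorm _) => x y c; lra.
Qed.

End SchattenNumericalRadius.

Theorem theorem4p6 (R : realType) (n : nat) (T : 'M[R[i]]_n) (e f g h : R -> R)
  (e_ge0 : forall t, 0 <= t -> 0 <= e t) (f_ge0 : forall t, 0 <= t -> 0 <= f t)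
  (g_ge0 : forall t, 0 <= t -> 0 <= g t) (h_ge0 : forall t, 0 <= t -> 0 <= h t)
  (e_cont : {within `[0, +oo[%classic, continuous e}) (f_cont : {within `[0, +oo[%classic, continuous f})
  (g_cont : {within `[0, +oo[%classic, continuous g}) (h_cont : {within `[0, +oo[%classic, continuous h})
  (fg : forall t, 0 <= t -> f t * g t = t) (eh : forall t, 0 <= t -> e t * h t = t)
  (p : R) (p_gt0 : 0 < p) :
  wp p T <=
    2^-1 * powR (opnorm (fcalc (fun t => g t ^+ 2) (absmx (adjmx T))
                         + fcalc (fun t => h t ^+ 2) (absmx T))) (2^-1)
         * powR (schatten (p / 2) (fcalc (fun t => f t ^+ 2) (absmx T)
                                  + fcalc (fun t => e t ^+ 2) (absmx (adjmx T)))) (2^-1).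
Proof.
apply: ge_sup.
  (* A supremum bound needs a nonempty set; [l = 1] gives a member. *)
  by exists (schatten p (Defs.ReM (1 *: T))); exists 1 => //=; rewrite normr1.
by move=> _ [l /= l1 <-]; exact: schatten_ReM_le.
Qed.
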